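(* The problem $d$-Coloring has extension complexity $d^{k}n^{O(1)}$ on $n$-vertex graphs of treewidth at most $k$. Under ETH, this problem has no extended formulation with $d^{o(k)}n^{O(1)}$ inequalities.
   Context: $d$-Coloring is the problem consisting of all pairs $(G,(X_1,\dots,X_d))$ where $G$ is a graph and $(X_1,\dots,X_d)$ is a partition of $V_G$ into independent sets. A solution $X=(X_1,\dots,X_d)$ is encoded as the 0/1 matrix $\hat X$ with $d$ rows and $|V_G|$ columns where $\hat X_{iv}=1$ iff $v\in X_i$; the solution polytope $P_{\Pi}(G)$ is the convex hull of all such matrices for solutions in $G$. A problem $\Pi$ has extension complexity $f(k,n)$ on $n$-vertex graphs of treewidth at most $k$ if for each such graph $G$, $P_{\Pi}(G)$ has extension complexity at most $f(k,n)$. $\Pi$ has no extended formulation with $g(k,n)$ inequalities if no polytope $P'$ that is an extended formulation of $P_{\Pi}(G)$ can be defined with $g(k,n)$ inequalities or fewer.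
   Formalization: The lower bound is stated for d ≥ 3 only, since for d = 1, 2 the polytope is empty, a point or an affine image of a cube and O(n) inequalities always suffice; the upper bound is stated for d ≥ 1, with d fixed, so the constants in n^{O(1)} may depend on d. *)

(* Defs.v *)
From HB Require Import structures.
From mathcomp Require Import all_boot all_order all_algebra.
From mathcomp Require Import all_classical all_reals all_analysis.
Set Implicit Arguments.
Unset Strict Implicit.
Unset Printing Implicit Defensive.
Import Order.TTheory GRing.Theory Num.Theory.
Import numFieldNormedType.Exports.
Local Open Scope classical_set_scope.
Local Open Scope ring_scope.

Record sgraph (V : finType) := SGraph {
  adj :> rel V;
  adj_sym : symmetric adj;
  adj_irr : irreflexive adj }.

Definition is_tree (T : finType) (t : sgraph T) : Prop :=
  [/\ (0 < #|T|)%N,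
      forall i j : T, connect t i j &
      forall p : seq T, ucycle t p -> (size p < 3)%N].

Record tree_decomposition (V T : finType) (G : sgraph V) (t : sgraph T)
    (B : T -> {set V}) : Prop := TreeDecomposition {
  td_tree : is_tree t;
  td_vertex : forall v : V, exists i : T, v \in B i;
  td_edge : forall u v : V, G u v -> exists i : T, (u \in B i) && (v \in B i);
  td_subtree : forall (v : V) (i j : T), v \in B i -> v \in B j ->
    connect [rel x y | [&& t x y, v \in B x & v \in B y]] i j }.

(* The width of a decomposition is the maximal bag size minus one. *)
Definition treewidth_le (V : finType) (G : sgraph V) (k : nat) : Prop :=
  exists (T : finType) (t : sgraph T) (B : T -> {set V}),
    tree_decomposition G t B /\ forall i : T, (#|B i| <= k.+1)%N.

Definition conv_hull (R : realType) (E : lmodType R) (S : set E) : set E :=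
  [set x | exists (N : nat) (p : 'I_N -> E) (a : 'I_N -> R),
     [/\ forall i, S (p i), forall i, 0 <= a i,
         \sum_(i < N) a i = 1 & x = \sum_(i < N) a i *: p i]].

(* Q is the solution set of a linear system with r inequalities; as usual for
   extended formulations, linear equations are allowed and not counted. *)
Definition defined_by_ineqs (R : realType) (m : nat) (Q : set 'cV[R]_m)
    (r : nat) : Prop :=
  exists (A : 'M[R]_(r, m)) (b : 'cV[R]_r)
         (q : nat) (C : 'M[R]_(q, m)) (e : 'cV[R]_q),
    Q = [set y | (forall i, (A *m y) i 0 <= b i 0) /\ C *m y = e].

Definition is_polytope (R : realType) (m : nat) (Q : set 'cV[R]_m) : Prop :=
  (exists r, defined_by_ineqs Q r) /\
  (exists M : R, forall y, Q y -> forall i, `|y i 0| <= M).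

Definition extended_formulation (R : realType) (E : lmodType R) (P : set E)
    (m : nat) (Q : set 'cV[R]_m) : Prop :=
  is_polytope Q /\ exists pi : {linear 'cV[R]_m -> E}, pi @` Q = P.

(* xc(P) <= x, where xc(P) is the minimum number of inequalities defining an
   extended formulation of P. *)
Definition ext_complexity_le (R : realType) (E : lmodType R) (P : set E)
    (x : R) : Prop :=
  exists (m : nat) (Q : set 'cV[R]_m) (r : nat),
    [/\ extended_formulation P Q, defined_by_ineqs Q r & r%:R <= x].

(* Problems whose solutions are d-tuples of vertex sets. *)
Definition vertex_problem (d : nat) : Type :=
  forall n : nat, sgraph 'I_n -> set {ffun 'I_d -> {set 'I_n}}.

Definition independent (V : finType) (G : sgraph V) (A : {set V}) : Prop :=
  forall u v, u \in A -> v \in A -> ~~ G u v.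

(* Colour classes may be empty. *)
Definition coloring (d : nat) : vertex_problem d := fun n G =>
  [set X : {ffun 'I_d -> {set 'I_n}} |
     [/\ forall v, exists i, v \in X i,
         forall i j, i != j -> [disjoint X i & X j]%B &
         forall i, independent G (X i)]].

Definition solution_mx (R : realType) (d n : nat)
    (X : {ffun 'I_d -> {set 'I_n}}) : 'M[R]_(d, n) :=
  \matrix_(i, v) (v \in X i)%:R.

Definition solution_polytope (R : realType) (d : nat) (Pi : vertex_problem d)
    (n : nat) (G : sgraph 'I_n) : set 'M[R]_(d, n) :=
  conv_hull (@solution_mx R d n @` Pi n G).
Arguments solution_polytope R {d} Pi {n} G.

Definition has_ext_complexity (R : realType) (d : nat) (Pi : vertex_problem d)
    (f : nat -> nat -> R) : Prop :=
  forall (k n : nat) (G : sgraph 'I_n), treewidth_le G k ->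
    ext_complexity_le (solution_polytope R Pi G) (f k n).

(* The bound g fails for some graph of treewidth at most k. *)
Definition no_ext_formulation (R : realType) (d : nat) (Pi : vertex_problem d)
    (g : nat -> nat -> R) : Prop :=
  exists (k n : nat) (G : sgraph 'I_n), treewidth_le G k /\
    forall (m : nat) (Q : set 'cV[R]_m),
      extended_formulation (solution_polytope R Pi G) Q ->
      forall r : nat, defined_by_ineqs Q r -> g k n < r%:R.

(* The class n^O(1). The factor C cannot be dropped: for n = 1 the d-colouring
   polytope is a simplex with d vertices. *)
Definition poly_bounded (R : realType) (p : nat -> R) : Prop :=
  exists C c : nat, forall n, p n <= C%:R * n%:R ^+ c.

Inductive move := MoveL | MoveR | Stay.

Record tm (A : finType) := TM {
  tm_state : finType;
  tm_work : finType;
  tm_start : tm_state;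
  tm_halt : tm_state -> option bool;  (* Some b: halt with answer b *)
  tm_delta : tm_state -> option (A + tm_work) ->
             tm_state * option (A + tm_work) * move }.

(* Tape cells contain an input symbol, a work symbol, or the blank None. *)
Definition cell (A : finType) (M : tm A) : Type := option (A + tm_work M).

(* The cells left of the head (nearest first), the scanned cell, and the cells
   right of it; the two-way infinite tape is blank beyond the stored cells. *)
Record config (A : finType) (M : tm A) := Config {
  c_state : tm_state M;
  c_left : seq (cell M);
  c_head : cell M;
  c_right : seq (cell M) }.

Definition tm_init (A : finType) (M : tm A) (w : seq A) : config M :=
  let s : seq (cell M) := [seq Some (inl a) | a <- w] in
  Config (tm_start M) [::] (head None s) (behead s).

Definition tm_step (A : finType) (M : tm A) (c : config M) : config M :=
  if tm_halt (c_state c) is Some _ then c else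
  let: (q, x, mv) := tm_delta (c_state c) (c_head c) in
  match mv with
  | MoveL => Config q (behead (c_left c)) (head None (c_left c))
                    (x :: c_right c)
  | MoveR => Config q (x :: c_left c) (head None (c_right c))
                    (behead (c_right c))
  | Stay => Config q (c_left c) x (c_right c)
  end.

Definition tm_answer (A : finType) (M : tm A) (w : seq A) (t : nat) :
    option bool :=
  tm_halt (c_state (iter t (@tm_step A M) (tm_init M w))).

(* The literal (b, i) is the variable x_i if b and its negation otherwise. *)
Definition literal : Type := (bool * nat)%type.
Definition clause : Type := seq literal.
Definition cnf : Type := seq clause.

Definition is_3cnf (phi : cnf) : bool := all (fun c => size c <= 3)%N phi.

Definition satisfiable (phi : cnf) : Prop :=
  exists a : nat -> bool, all (has (fun l : literal => a l.2 == l.1)) phi.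

Definition nvars (phi : cnf) : nat :=
  size (undup [seq l.2 | l : literal <- flatten phi]).

(* Words over option bool: a literal (b, i) is written as its sign Some b
   followed by i blocks [None; Some true], that is, with its index in unary;
   a clause is terminated by [None; Some false]. *)
Definition encode_literal (l : literal) : seq (option bool) :=
  Some l.1 :: flatten (nseq l.2 [:: None; Some true]).
Definition encode (phi : cnf) : seq (option bool) :=
  flatten [seq flatten (map encode_literal c) ++ [:: None; Some false]
          | c : clause <- phi].

(* M decides 3-SAT in time O*(2 ^ (delta n)), n the number of variables. *)
Definition solves_3sat_in (R : realType) (M : tm (option bool)) (delta : R) :
    Prop :=
  exists C c : nat, forall phi : cnf, is_3cnf phi ->
    exists (t : nat) (b : bool),
      [/\ t%:R <= C%:R * 2 `^ (delta * (nvars phi)%:R)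
                  * (size (encode phi)).+1%:R ^+ c,
          tm_answer M (encode phi) t = Some b &
          b <-> satisfiable phi].

(* Exponential Time Hypothesis (Impagliazzo-Paturi): the infimum of all delta
   for which 3-SAT is solvable in time O*(2 ^ (delta n)) is positive. *)
Definition ETH (R : realType) : Prop :=
  exists delta : R, 0 < delta /\
    ~ exists M : tm (option bool), solves_3sat_in M delta.

(* Main.v *)
Require Import Defs.
From HB Require Import structures.
From mathcomp Require Import all_boot all_order all_algebra.
From mathcomp Require Import all_classical all_reals all_analysis.
From mathcomp Require Import zify ring lra.
Set Implicit Arguments.
Unset Strict Implicit.
Unset Printing Implicit Defensive.
Import Order.TTheory GRing.Theory Num.Theory.
Import numFieldNormedType.Exports.
Local Open Scope classical_set_scope.
Local Open Scope ring_scope.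

(** Upper bound.  A decomposition of width k, rooted anywhere, gives an
    elimination order in which each vertex v has a bag A v of at most k + 1
    vertices, so there are at most n d^(k+1) pairs of a vertex and a coloring of
    its bag.  The formulation is the set of nonnegative vectors indexed by these
    pairs in the affine hull of the indicator vectors of the proper colorings.
    Following the order, one finds greedily a proper coloring on all of whose
    bag restrictions a given point is positive; subtracting multiples of such
    colorings exhausts the point, which is thus a convex combination of them.

    Lower bound.  It holds unconditionally.  A graph on m + 2 m^2 vertices, of
    treewidth at most m + 1, has colorings x_b and valid inequalities L_a >= 0
    indexed by the subsets of [m] with L_a(x_b) = (1 - |a :&: b|)^2, as in the
    correlation polytope.  The inequalities of an extended formulation cover
    the disjoint pairs (a, b) by rectangles free of pairs with |a :&: b| = 1;
    each contains at most 2^m of the 3^m disjoint pairs (Kaibel and Weltge),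
    and (3/2)^m is not d^(o(m)) m^(O(1)). *)

(** * Rectangles in the disjointness matrix *)

(** This sums over the disjoint pairs of subsets of [n], given as characteristic lists; the three
    terms are the possible pairs of first entries. *)
Fixpoint disjoint_sum (n : nat) (P : seq bool -> seq bool -> nat) : nat :=
  if n is k.+1 then
    (disjoint_sum k (fun a b => P (false :: a) (false :: b)) +
     disjoint_sum k (fun a b => P (true :: a) (false :: b)) +
     disjoint_sum k (fun a b => P (false :: a) (true :: b)))%N
  else P [::] [::].

Definition meet_count (a b : seq bool) : nat :=
  count (fun p : bool * bool => p.1 && p.2) (zip a b).

Lemma leq_disjoint_sum n (P P' : seq bool -> seq bool -> nat) :
  (forall a b, size a = n -> size b = n -> meet_count a b = 0%N ->
     (P a b <= P' a b)%N) ->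
  (disjoint_sum n P <= disjoint_sum n P')%N.
Proof.
elim: n P P' => [|n IHn] P P' leP /=; first exact: leP.
by apply: leq_add; [apply: leq_add|]; apply: IHn => a b sa sb ab0;
  apply: leP => //=; rewrite ?sa ?sb.
Qed.

Lemma disjoint_sumD n (P P' : seq bool -> seq bool -> nat) :
  disjoint_sum n (fun a b => P a b + P' a b)%N =
  (disjoint_sum n P + disjoint_sum n P')%N.
Proof. by elim: n P P' => [//|n IHn] P P' /=; rewrite !IHn; lia. Qed.

Lemma disjoint_sum_sum (I : finType) n (F : I -> seq bool -> seq bool -> nat) :
  disjoint_sum n (fun a b => \sum_(i : I) F i a b)%N =
  (\sum_(i : I) disjoint_sum n (F i))%N.
Proof.
by elim: n F => [//|n IHn] F /=; rewrite !IHn -!big_split.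
Qed.

Lemma disjoint_sum1 n : disjoint_sum n (fun _ _ => 1%N) = (3 ^ n)%N.
Proof. by elim: n => [//|n /= ->]; rewrite expnS; lia. Qed.

(* The Kaibel-Weltge bound.  A pair that is disjoint after removing the first
   coordinate cannot have a 1 there on both sides, so the three restrictions of
   the rectangle are dominated by two rectangles of the same kind. *)
Lemma disjoint_sum_rectangle n (A B : pred (seq bool)) :
  (forall a b, size a = n -> size b = n -> A a -> B b ->
     meet_count a b != 1%N) ->
  (disjoint_sum n (fun a b => A a && B b) <= 2 ^ n)%N.
Proof.
elim: n A B => [|n IHn] A B AB1 /=; first by case: (_ && _).
pose A0 a := A (false :: a); pose A1 a := A (true :: a).
pose B0 b := B (false :: b); pose B1 b := B (true :: b).
have le1 : (disjoint_sum n (fun a b => (A0 a || A1 a) && B0 b) <= 2 ^ n)%N.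
  apply: IHn => a b sa sb /orP[] Aa Bb.
    by apply: (AB1 (false :: a) (false :: b)) => //=; rewrite ?sa ?sb.
  by apply: (AB1 (true :: a) (false :: b)) => //=; rewrite ?sa ?sb.
have le2 : (disjoint_sum n (fun a b => A0 a && (B0 b || B1 b)) <= 2 ^ n)%N.
  apply: IHn => a b sa sb Aa /orP[] Bb.
    by apply: (AB1 (false :: a) (false :: b)) => //=; rewrite ?sa ?sb.
  by apply: (AB1 (false :: a) (true :: b)) => //=; rewrite ?sa ?sb.
rewrite expnS mul2n -addnn; apply: leq_trans (leq_add le1 le2).
(* Pointwise, the three terms exceed the two bounds only if [A0 a], [A1 a], [B0 b] and [B1 b] all
   hold; but [A1 a] and [B1 b] together give a pair meeting exactly once. *)
rewrite -!disjoint_sumD; apply: leq_disjoint_sum => a b sa sb ab0.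
have : ~~ (A1 a && B1 b).
  apply/negP => /andP[Aa Bb].
  have /= := AB1 (true :: a) (true :: b); rewrite sa sb => /(_ erefl erefl Aa Bb).
  by rewrite /meet_count /= -/(meet_count a b) ab0.
rewrite /A0 /A1 /B0 /B1.
by do 4 case: (_ (_ :: _)).
Qed.

Lemma card_meet m (a b : seq bool) : size a = m -> size b = m ->
  #|([set i : 'I_m | nth false a i] :&: [set i : 'I_m | nth false b i])%SET| =
  meet_count a b.
Proof.
move=> sa sb; rewrite -sum1_card big_mkcond /=.
under eq_bigr => i _ do rewrite !inE.
elim: m a b sa sb => [|m IHm] [|x a] [|y b] //=; first by rewrite big_ord0.
by move=> [sa] [sb]; rewrite big_ord_recl /= IHm // /meet_count /=; case: (x && y).
Qed.

(** Double counting: each of the [3 ^ m] disjoint pairs lies in some rectangle, and each rectangle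
    holds at most [2 ^ m] of them. *)
Lemma leq_disjointness_cover (I : finType) m (A B : I -> pred {set 'I_m}) :
  (forall i a b, A i a -> B i b -> #|a :&: b| != 1%N) ->
  (forall a b, a :&: b = finset.set0 -> exists i, A i a && B i b) ->
  (3 ^ m <= #|I| * 2 ^ m)%N.
Proof.
move=> AB1 cov; pose S (a : seq bool) := [set i : 'I_m | nth false a i]%SET.
rewrite -disjoint_sum1 -sum_nat_const.
apply: leq_trans
  (_ : _ <= disjoint_sum m (fun a b => \sum_(i : I) (A i (S a) && B i (S b))))%N _.
  apply: leq_disjoint_sum => a b sa sb ab0.
  have [|i Hi] := cov (S a) (S b); first by apply: cards0_eq; rewrite card_meet.
  by rewrite (bigD1 i) //= Hi.
rewrite disjoint_sum_sum; apply: leq_sum => i _.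
apply: (@disjoint_sum_rectangle m (fun a => A i (S a)) (fun b => B i (S b))).
by move=> a b sa sb Aa Bb; rewrite -(card_meet sa sb); apply: (AB1 i).
Qed.

(** * Faces of extended formulations *)

(** A ratio test: adding 1 to [|D i|] keeps the denominators positive, and starting the minimum at 1
    covers an empty index set. *)
Lemma positive_step (R : realType) (I : finType) (P : pred I) (x D : I -> R) :
  (forall i, P i -> 0 < x i) ->
  exists2 t : R, 0 < t & forall i, P i -> t * D i <= x i.
Proof.
move=> x0; have D0 i : 0 < `|D i| + 1 by rewrite ltr_wpDl.
exists (\big[Num.min/1]_(i | P i) (x i / (`|D i| + 1))).
  by apply: lt_bigmin => // i Pi; rewrite divr_gt0 // x0.
move=> i Pi; set t := \big[_/_]_(_ | _) _.
have t0 : 0 <= t by apply: le_bigmin => // j Pj; rewrite divr_ge0 // ltW // x0.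
apply: le_trans (_ : t * (`|D i| + 1) <= _).
  by rewrite ler_wpM2l // (le_trans (ler_norm _)) // lerDl.
by rewrite -ler_pdivlMr //; apply: bigmin_le_cond.
Qed.

(* A face of a polyhedron is cut out by the inequalities that are tight on it:
   from a point z of the face at which no other inequality is tight, one can
   move a little away from any point y satisfying the tight ones. *)
Lemma face_tight_ineqs (R : realType) (m r q : nat) (A : 'M[R]_(r, m))
    (b : 'cV[R]_r) (C : 'M[R]_(q, m)) (e : 'cV[R]_q)
    (s : 'cV[R]_m -> R) (y0 : 'cV[R]_m) :
  let Q y := (forall i, (A *m y) i 0 <= b i 0) /\ C *m y = e in
  (forall t y z, s (y + t *: (z - y)) = s y + t * (s z - s y)) ->
  (forall y, Q y -> 0 <= s y) -> Q y0 -> s y0 = 0 ->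
  exists J : {set 'I_r}, forall y, Q y ->
    (s y = 0 <-> forall i, i \in J -> (A *m y) i 0 = b i 0).
Proof.
move=> Q aff pos Qy0 sy0.
pose J := [set i : 'I_r | `[< forall y, Q y -> s y = 0 ->
  (A *m y) i 0 = b i 0 >]]%SET.
have AE t y z i : (A *m (y + t *: (z - y))) i 0 =
    (A *m y) i 0 + t * ((A *m z) i 0 - (A *m y) i 0).
  rewrite mulmxDr -scalemxAr mulmxBr mxE [X in _ + X]mxE [X in _ * X]mxE.
  by rewrite [X in _ * (_ + X)]mxE.
have CE t y z : C *m y = e -> C *m z = e -> C *m (y + t *: (z - y)) = e.
  by move=> Cy Cz; rewrite mulmxDr -scalemxAr mulmxBr Cy Cz subrr scaler0 addr0.
exists J => y Qy; split=> [sy i|tight].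
  by rewrite inE => /asboolP /(_ _ Qy sy).
(* Starting from [y0], average in turn with a face point at which the next inequality outside [J] is
   strict; midpoints keep the strictness already gained. *)
have [z [Qz sz zJ]] : exists z, [/\ Q z, s z = 0 &
    forall i, i \in enum 'I_r -> i \notin J -> (A *m z) i 0 < b i 0].
  elim: (enum 'I_r) => [|i l [z [Qz sz zl]]]; first by exists y0.
  case: (boolP (i \in J)) => iJ.
    exists z; split=> // j; rewrite inE => /orP[/eqP-> /negP//|]; exact: zl.
  have [w [Qw sw wi]] : exists w, [/\ Q w, s w = 0 & (A *m w) i 0 < b i 0].
    apply: contrapT => Hn; move/negP: iJ; apply; rewrite inE.
    apply/asboolP => w Qw sw; apply/eqP; rewrite eq_le Qw.1 /= leNgt.
    by apply/negP => lt; apply: Hn; exists w.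
  exists (z + 2^-1 *: (w - z)); split.
  - split=> [j|]; last exact: CE Qz.2 Qw.2.
    by rewrite AE; have := Qz.1 j; have := Qw.1 j; lra.
  - by rewrite aff sz sw; lra.
  - move=> j; rewrite inE AE => /orP[/eqP-> _|jl jJ].
      by have := Qz.1 i; lra.
    by have := Qw.1 j; have := zl j jl jJ; lra.
have [|t t0 tP] := @positive_step R 'I_r (fun i => i \notin J)
    (fun i => b i 0 - (A *m z) i 0) (fun i => (A *m z) i 0 - (A *m y) i 0).
  by move=> i iJ; rewrite subr_gt0 zJ ?mem_enum.
have Qw : Q (z + (- t) *: (y - z)).
  split=> [i|]; last exact: CE Qz.2 Qy.2.
  rewrite AE; case: (boolP (i \in J)) => iJ; last by have := tP i iJ; lra.
  have -> : (A *m z) i 0 = b i 0.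
    by move: iJ; rewrite inE => /asboolP; apply.
  by rewrite tight // subrr mulr0 addr0.
apply/eqP; rewrite eq_le pos // andbT.
by have := pos _ Qw; rewrite aff sz add0r subr0 mulNr oppr_ge0 pmulr_rle0.
Qed.

(* The inequalities of an extended formulation give rectangles covering the
   support of every slack matrix, here one with the unique-disjointness pattern;
   the extra rectangle [None] takes care of the row of the empty set. *)
Lemma leq_extension_disjointness (R : realType) (E : lmodType R) (P : set E)
    (m r k : nat) (Q : set 'cV[R]_k) (L : {set 'I_m} -> E -> R)
    (x : {set 'I_m} -> E) :
  (forall a t y z, L a (y + t *: (z - y)) = L a y + t * (L a z - L a y)) ->
  (forall a y, P y -> 0 <= L a y) -> (forall b, P (x b)) ->
  (forall a b, L a (x b) = (1 - #|a :&: b|%:R) ^+ 2) ->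
  extended_formulation P Q -> defined_by_ineqs Q r ->
  (3 ^ m <= r.+1 * 2 ^ m)%N.
Proof.
move=> aff pos Px Lx [_ [pi piQ]] [A [b [q [C [e QE]]]]].
have /choice[y yP] : forall b', exists y, Q y /\ pi y = x b'.
  by move=> b'; have := Px b'; rewrite -piQ => -[y Qy <-]; exists y.
have QP z : Q z -> P (pi z) by move=> Qz; rewrite -piQ; exists z.
have /choice[J JP] : forall a : {set 'I_m}, exists J : {set 'I_r},
    a != finset.set0 -> forall z, Q z ->
    (L a (pi z) = 0 <-> forall i, i \in J -> (A *m z) i 0 = b i 0).
  move=> a; have [->|/set0Pn[i ia]] := eqVneq a finset.set0; first by exists finset.set0.
  (* The face is nonempty: a singleton inside [a] meets [a] exactly once, so [L a] vanishes there.
     The empty set has no such witness. *)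
  have [||||J JP] := @face_tight_ineqs R k r q A b C e (fun z => L a (pi z)) (y [set i]%SET).
  - by move=> t u v; rewrite linearD linearZ linearB aff.
  - by move=> z Qz; apply/pos/QP; rewrite QE.
  - by have [+ _] := yP [set i]%SET; rewrite QE.
  - have [_ ->] := yP [set i]%SET; rewrite Lx.
    have -> : (a :&: [set i] = [set i])%SET by apply/finset.setIidPr; rewrite finset.sub1set.
    by rewrite cards1 subrr expr0n.
  by exists J => _ z; rewrite QE => /JP.
(* The rectangle of inequality [i] pairs the faces on which [i] is tight with the points at which it
   is slack. *)
pose rA (i : option 'I_r) (a : {set 'I_m}) :=
  if i is Some i then (a != finset.set0) && (i \in J a) else a == finset.set0.
pose rB (i : option 'I_r) (b' : {set 'I_m}) :=
  if i is Some i then (A *m y b') i 0 != b i 0 else true.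
have := @leq_disjointness_cover (option 'I_r) m rA rB.
rewrite card_option card_ord; apply.
- move=> [i|] a b' /=; last by move=> /eqP-> _; rewrite finset.set0I cards0.
  move=> /andP[a0 iJ] tight; apply/eqP => ab1.
  have [Qy piy] := yP b'; have [/(_ _) Hl _] := JP a a0 _ Qy.
  by move/eqP: tight; apply; apply: Hl => //; rewrite piy Lx ab1 subrr expr0n.
- move=> a b' ab0; have [a0|a0] := eqVneq a finset.set0.
    by exists None; rewrite /= a0 eqxx.
  have [Qy piy] := yP b'; have [_ Hr] := JP a a0 _ Qy.
  have [i /andP[iJ ti]|none] := pickP (fun i => (i \in J a) && ((A *m y b') i 0 != b i 0)).
    by exists (Some i); rewrite /= a0 iJ ti.
  have : L a (pi (y b')) = 0.
    by apply: Hr => i iJ; have := none i; rewrite iJ => /negbFE/eqP.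
  by rewrite piy Lx ab0 cards0 subr0 expr1n => /eqP; rewrite oner_eq0.
Qed.

(** * The coloring polytope *)

Definition color_classes (d n : nat) (x : 'I_n -> 'I_d) : {ffun 'I_d -> {set 'I_n}} :=
  [ffun i => [set v | x v == i]%SET].

Definition proper_coloring (V C : finType) (G : sgraph V) (x : V -> C) : bool :=
  [forall u, forall v, G u v ==> (x u != x v)].

Lemma proper_coloringP (V C : finType) (G : sgraph V) (x : V -> C) :
  reflect (forall u v, G u v -> x u != x v) (proper_coloring G x).
Proof. by apply: (iffP 'forall_'forall_implyP). Qed.

Lemma solution_mx_classes (R : realType) d n (x : 'I_n -> 'I_d) c v :
  solution_mx R (color_classes x) c v = (x v == c)%:R.
Proof. by rewrite mxE ffunE inE. Qed.

Lemma coloring_classes d n (G : sgraph 'I_n) (x : 'I_n -> 'I_d) :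
  proper_coloring G x -> coloring G (color_classes x).
Proof.
move=> /proper_coloringP prx; split.
- by move=> v; exists (x v); rewrite ffunE inE.
- move=> i j ij; rewrite disjoint_subset; apply/fintype.subsetP => v.
  by rewrite !ffunE !inE => /eqP->.
- by move=> i u v; rewrite !ffunE !inE => /eqP xu /eqP xv;
    apply/negP => /prx; rewrite xu xv eqxx.
Qed.

Lemma coloringP d n (G : sgraph 'I_n) (X : {ffun 'I_d -> {set 'I_n}}) :
  coloring G X -> exists2 x : {ffun 'I_n -> 'I_d}, proper_coloring G x & X = color_classes x.
Proof.
move=> [cov dis ind].
have /choice[x xP] : forall v, exists i, v \in X i by [].
exists (finfun x).
  apply/proper_coloringP => u v Guv; rewrite !ffunE; apply/negP => /eqP xuv.
  suff /(ind _ _ _ (xP u)) : v \in X (x u) by rewrite Guv.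
  by rewrite xuv.
apply/ffunP => i; rewrite ffunE; apply/setP => v; rewrite inE ffunE.
apply/idP/eqP => [vi|<-//]; apply/eqP/negPn/negP => xvi.
by have /pred0P/(_ v) := dis _ _ xvi; rewrite /= xP vi.
Qed.

(** Merging equal points of a convex combination turns its coefficients into a weight function on
    the fixed finite type of all color assignments. *)
Lemma coloring_polytopeP (R : realType) d n (G : sgraph 'I_n) (M : 'M[R]_(d, n)) :
  solution_polytope R (@coloring d) G M <->
  exists a : {ffun 'I_n -> 'I_d} -> R,
    [/\ forall x, 0 <= a x, forall x : {ffun 'I_n -> 'I_d}, ~~ proper_coloring G x -> a x = 0,
        \sum_x a x = 1 & M = \sum_x a x *: solution_mx R (color_classes x)].
Proof.
split=> [[N [p [a [pS a0 a1 ->]]]]|[a [a0 aP a1 ->]]].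
  have /choice[x xP] : forall i, exists x : {ffun 'I_n -> 'I_d},
      proper_coloring G x /\ p i = solution_mx R (color_classes x).
    by move=> i; have [X /coloringP[x prx ->] <-] := pS i; exists x.
  exists (fun z => \sum_(i | x i == z) a i); split.
  - by move=> z; apply: sumr_ge0.
  - move=> z prz; apply: big_pred0 => i; apply: contraNF prz => /eqP<-.
    by have [] := xP i.
  - by rewrite -a1 [RHS](partition_big x predT).
  - rewrite [LHS](partition_big x predT) //; apply: eq_bigr => z _.
    by rewrite scaler_suml; apply: eq_bigr => i /eqP<-; have [_ ->] := xP i.
pose S := [pred x : {ffun 'I_n -> 'I_d} | proper_coloring G x].
have sumS (T : lmodType R) (F : {ffun 'I_n -> 'I_d} -> T) :
    \sum_x a x *: F x = \sum_(x in S) a x *: F x.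
  rewrite [LHS](bigID (mem S)) /= [X in _ + X]big1 ?addr0 // => z.
  by move=> /aP ->; rewrite scale0r.
pose ev (i : 'I_#|S|) : {ffun 'I_n -> 'I_d} := enum_val i.
exists #|S|, (fun i => solution_mx R (color_classes (ev i))), (a \o ev).
split=> //=.
- move=> i; exists (color_classes (ev i)) => //; apply: coloring_classes.
  exact: (enum_valP i).
- rewrite /ev -(big_enum_val a) /= -a1.
  have := sumS R^o (fun=> 1); rewrite /GRing.scale /=.
  by under eq_bigr do rewrite mulr1; under [RHS]eq_bigr do rewrite mulr1.
- by rewrite sumS big_enum_val.
Qed.

(** * The lower bound *)

Definition gadget_vertex (m : nat) : finType := ('I_m + 'I_m * 'I_m * bool)%type.

(* The variable vertices [inl i], and for all i, j a path from [inl i] to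
   [inl j] with the inner vertices [inr (i, j, true)] and [inr (i, j, false)]. *)
Definition gadget_arc (m : nat) (u v : gadget_vertex m) : bool :=
  match u, v with
  | inl k, inr (i, j, s) => k == (if s then i else j)
  | inr (i, j, true), inr (i', j', false) => (i == i') && (j == j')
  | _, _ => false
  end.

Definition gadget_adj (m : nat) : rel 'I_#|gadget_vertex m| :=
  fun u v => gadget_arc (enum_val u) (enum_val v)
          || gadget_arc (enum_val v) (enum_val u).

Lemma gadget_adj_sym m : symmetric (@gadget_adj m).
Proof. by move=> u v; rewrite /gadget_adj orbC. Qed.

Lemma gadget_adj_irr m : irreflexive (@gadget_adj m).
Proof. by move=> u; rewrite /gadget_adj orbb; case: (enum_val u) => [|[[? ?] []]]. Qed.

Definition gadget (m : nat) : sgraph 'I_#|gadget_vertex m| :=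
  SGraph (@gadget_adj_sym m) (@gadget_adj_irr m).

Definition star_adj (I : finType) : rel (option I) :=
  fun x y => (x == None) (+) (y == None).

Lemma star_adj_sym I : symmetric (@star_adj I).
Proof. by move=> x y; rewrite /star_adj addbC. Qed.

Lemma star_adj_irr I : irreflexive (@star_adj I).
Proof. by move=> x; rewrite /star_adj addbb. Qed.

Definition star (I : finType) : sgraph (option I) :=
  SGraph (@star_adj_sym I) (@star_adj_irr I).

Lemma star_connect (I : finType) (x y : option I) : connect (star I) x y.
Proof.
apply: (@connect_trans _ _ None).
  by case: x => [x|]; [apply: connect1 | apply: connect0].
by case: y => [y|]; [apply: connect1 | apply: connect0].
Qed.

Lemma star_is_tree (I : finType) : is_tree (star I).
Proof.
split=> [||p].
- by rewrite card_option.
- exact: star_connect.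
- by case: p => [|[x|] [|[y|] [|[z|] [|[w|] p]]]] //; rewrite /ucycle /= => /andP[];
    rewrite ?inE /star_adj /= ?andbF ?andbT ?orbT //= ?orbT.
Qed.

(** The decomposition tree is a star: every bag contains the [m] variable vertices, and the leaf of
    (i, j) adds the two inner vertices of that path. *)
Lemma gadget_treewidth m : treewidth_le (gadget m) m.+1.
Proof.
pose C (o : option ('I_m * 'I_m)) : {set gadget_vertex m} :=
  ([set inl i | i : 'I_m] :|:
   (if o is Some p then [set inr (p, true); inr (p, false)] else finset.set0))%SET.
pose B o : {set 'I_#|gadget_vertex m|} := (enum_val @^-1: C o)%SET.
have BE o v : (v \in B o) = (enum_val v \in C o) by rewrite inE.
have Cl i o : inl i \in C o by rewrite inE imset_f.
have Cr p s o : (inr (p, s) \in C o) = (o == Some p).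
  rewrite inE; have -> : (inr (p, s) \in [set inl i | i : 'I_m]%SET) = false.
    by apply/negbTE/imsetP => -[].
  case: o => [p'|]; rewrite !inE //=; apply/idP/eqP => [|[->]].
    by move=> /orP[] /eqP[->].
  by case: s; rewrite eqxx ?orbT.
exists (option ('I_m * 'I_m)), (star _), B; split; last first.
  move=> o; rewrite -(card_imset _ enum_val_inj).
  apply: leq_trans (_ : #|C o| <= _)%N.
    by apply/subset_leq_card/fintype.subsetP => v /imsetP[u]; rewrite BE => ? ->.
  rewrite -addn2; apply: (leq_trans (leq_card_setU _ _)); apply: leq_add.
    by rewrite (leq_trans (leq_imset_card _ _)) // card_ord.
  by case: o => [p|]; rewrite ?cards0 // cards2; case: (_ != _).
split=> [|v|u v|v i j].
- exact: star_is_tree.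
- case E: (enum_val v) => [i|[p s]].
    by exists None; rewrite BE E Cl.
  by exists (Some p); rewrite BE E Cr.
- have arcP (w w' : gadget_vertex m) : gadget_arc w w' ->
      exists o, (w \in C o) && (w' \in C o).
    case: w w' => [k|[[i j] []]] [k'|[[i' j'] []]] //=.
    + by move=> _; exists (Some (i', j')); rewrite Cl Cr eqxx.
    + by move=> _; exists (Some (i', j')); rewrite Cl Cr eqxx.
    + by move=> /andP[/eqP<- /eqP<-]; exists (Some (i, j)); rewrite !Cr eqxx.
  rewrite /= /gadget_adj => /orP[] /arcP[t] /andP[h1 h2]; exists t; rewrite !BE.
    by rewrite h1 h2.
  by rewrite h1 h2.
- rewrite !BE; case E: (enum_val v) => [k|[p s]].
    move=> _ _; have := star_connect i j; apply: connect_sub.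
    by move=> x y xy; apply: connect1; rewrite /= !BE E !Cl !andbT.
  by rewrite !Cr => /eqP-> /eqP->; apply: connect0.
Qed.

(** * Valid inequalities with the unique-disjointness pattern *)

Section GadgetFunctional.
Variables (R : realType) (d m : nat) (c0 c1 c2 : 'I_d).
Hypotheses (c01 : c0 != c1) (c02 : c0 != c2) (c12 : c1 != c2).

(** Color [c1] on a variable vertex encodes membership in [b]. An inner vertex gets [c0] only when
    both ends of its path lie in [b], and then exactly one does. *)
Definition gadget_color (b : {set 'I_m}) (v : gadget_vertex m) : 'I_d :=
  match v with
  | inl i => if i \in b then c1 else c0
  | inr (i, _, true) => if i \in b then c2 else c1
  | inr (i, j, false) => if i \in b then if j \in b then c0 else c1 else c2
  end.

Definition gadget_coloring (b : {set 'I_m}) (u : 'I_#|gadget_vertex m|) :=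
  gadget_color b (enum_val u).

Lemma gadget_coloring_proper b : proper_coloring (gadget m) (gadget_coloring b).
Proof.
have arcP (w w' : gadget_vertex m) : gadget_arc w w' ->
    gadget_color b w != gadget_color b w'.
  case: w w' => [k|[[i j] []]] [k'|[[i' j'] []]] //=.
  - by move=> /eqP->; case: ifP.
  - by move=> /eqP->; do 2 case: ifP => //; rewrite 1?eq_sym.
  - by move=> /andP[/eqP<- /eqP<-]; do 2 case: ifP => //; rewrite 1?eq_sym.
apply/proper_coloringP => u v /=; rewrite /gadget_adj /gadget_coloring => /orP[] /arcP //.
by rewrite eq_sym.
Qed.

(* If both ends of the path of (i, j) have color c1, then its inner vertices
   cannot use the colors c1 and c2 only. *)
Definition gadget_weight (a : {set 'I_m}) (c : 'I_d) (v : gadget_vertex m) : R :=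
  match v with
  | inl i => - 2 * ((i \in a) && (c == c1))%:R
  | inr (i, j, _) => [&& i \in a, j \in a, c != c1 & c != c2]%:R
  end.

Definition gadget_functional (a : {set 'I_m}) (M : 'M[R]_(d, #|gadget_vertex m|)) : R :=
  1 + \sum_u \sum_c gadget_weight a c (enum_val u) * M c u.

Lemma gadget_functional_affine a t y z :
  gadget_functional a (y + t *: (z - y)) =
  gadget_functional a y + t * (gadget_functional a z - gadget_functional a y).
Proof.
rewrite /gadget_functional opprD addrACA subrr add0r -sumrB mulr_sumr -addrA -big_split /=; congr +%R.
apply: eq_bigr => u _; rewrite -sumrB mulr_sumr -big_split /=.
by apply: eq_bigr => c _; rewrite !mxE; ring.
Qed.

Lemma gadget_functional_classes a (x : 'I_#|gadget_vertex m| -> 'I_d)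
    (z := fun v => x (enum_rank v)) :
  gadget_functional a (solution_mx R (color_classes x)) =
  1 - 2 * (\sum_(i : 'I_m) ((i \in a) && (z (inl i) == c1))%:R) +
  \sum_(i : 'I_m) \sum_(j : 'I_m)
    (gadget_weight a (z (inr (i, j, true))) (inr (i, j, true)) +
     gadget_weight a (z (inr (i, j, false))) (inr (i, j, false))).
Proof.
rewrite /gadget_functional -addrA; congr +%R.
pose F (v : gadget_vertex m) := gadget_weight a (z v) v.
transitivity (\sum_(v : gadget_vertex m) F v).
  rewrite (big_enum_val F); apply: eq_bigr => u _; rewrite /F /z enum_valK.
  rewrite (bigD1 (x u)) //= solution_mx_classes eqxx mulr1 big1 ?addr0 // => c cx.
  by rewrite solution_mx_classes eq_sym (negbTE cx) mulr0.
rewrite big_sumType /=; congr +%R.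
  by rewrite /F /= -mulr_sumr mulNr.
rewrite (pair_bigA _ (fun i j => F (inr (i, j, true)) + F (inr (i, j, false)))) /=.
transitivity (\sum_(p : 'I_m * 'I_m) \sum_(s : bool) F (inr (p, s))).
  by rewrite pair_bigA; apply: eq_bigr => -[].
by apply: eq_bigr => -[i j] _; rewrite big_bool.
Qed.

Lemma gadget_functional_ge0 a (x : 'I_#|gadget_vertex m| -> 'I_d) :
  proper_coloring (gadget m) x -> 0 <= gadget_functional a (solution_mx R (color_classes x)).
Proof.
move=> /proper_coloringP prx; rewrite gadget_functional_classes.
set s := \sum_(i : 'I_m) _; set q := \sum_(i : 'I_m) _.
(* The value is 1 - 2 s + q, and q >= s^2 bounds it below by (1 - s)^2; q and s^2 are compared one
   pair (i, j) at a time. *)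
suff sq : s * s <= q by have := sqr_ge0 (1 - s); rewrite expr2; lra.
rewrite /s big_distrlr /=; apply: ler_sum => i _; apply: ler_sum => j _.
rewrite -natrM -natrD ler_nat.
case: (boolP (i \in a)) => //= ia; case: (boolP (j \in a)) => ja; last by rewrite muln0.
have p1 := prx (enum_rank (inl i)) (enum_rank (inr (i, j, true))).
have p2 := prx (enum_rank (inr (i, j, true))) (enum_rank (inr (i, j, false))).
have p3 := prx (enum_rank (inl j)) (enum_rank (inr (i, j, false))).
move: p1 p2 p3; rewrite /= /gadget_adj !enum_rankK /= !eqxx /=.
move=> /(_ isT) p1 /(_ isT) p2 /(_ isT) p3.
move: (x (enum_rank (inl i))) (x (enum_rank (inl j))) (x (enum_rank (inr (i, j, true))))
  (x (enum_rank (inr (i, j, false)))) p1 p2 p3 => ci cj cy cz p1 p2 p3.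
have [ci1|] := eqVneq ci c1; last by rewrite mul0n.
have [cj1|] := eqVneq cj c1; last by rewrite muln0.
rewrite -ci1 eq_sym p1 /= ci1 -cj1 [X in ~~ X && _]eq_sym p3 /=.
by have [cy2|//] := eqVneq cy c2; rewrite -cy2 eq_sym p2.
Qed.

Lemma gadget_functional_coloring a b :
  gadget_functional a (solution_mx R (color_classes (gadget_coloring b))) =
  (1 - #|a :&: b|%:R) ^+ 2.
Proof.
rewrite gadget_functional_classes /gadget_coloring.
set s := \sum_(i : 'I_m) _; set q := \sum_(i : 'I_m) _.
have sE : s = \sum_(i : 'I_m) ((i \in a) && (i \in b))%:R.
  apply: eq_bigr => i _; rewrite enum_rankK /=.
  by case: (i \in b); rewrite ?eqxx ?(negbTE c01).
have -> : #|a :&: b|%:R = s.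
  rewrite sE -sum1_card natr_sum big_mkcond /=.
  by apply: eq_bigr => i _; rewrite inE; case: (_ && _).
suff -> : q = s * s by ring.
rewrite sE big_distrlr /=; apply: eq_bigr => i _; apply: eq_bigr => j _.
rewrite !enum_rankK /= -natrM -natrD; congr (_%:R).
case: (i \in a) => //=; case: (j \in a) => /=; last by rewrite muln0.
by case: (i \in b); case: (j \in b);
  rewrite ?eqxx ?c01 ?c02 ?c12 ?andbF //= ?(eq_sym c2) ?c12.
Qed.

End GadgetFunctional.

Lemma gadget_extension_complexity (R : realType) (d m r k : nat) (Q : set 'cV[R]_k) :
  (3 <= d)%N ->
  extended_formulation (solution_polytope R (@coloring d) (gadget m)) Q ->
  defined_by_ineqs Q r -> (3 ^ m <= r.+1 * 2 ^ m)%N.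
Proof.
move=> d3.
pose c0 := Ordinal (ltn_trans (isT : 0 < 2)%N d3).
pose c1 := Ordinal (ltn_trans (isT : 1 < 2)%N d3).
pose c2 := Ordinal d3.
have c01 : c0 != c1 by [].
have c02 : c0 != c2 by [].
have c12 : c1 != c2 by [].
apply: (@leq_extension_disjointness R _ _ m r k Q (gadget_functional c1 c2)
  (fun b => solution_mx R (color_classes (gadget_coloring c0 c1 c2 b)))).
- exact: gadget_functional_affine.
(* The weights sum to 1, so the affine functional commutes with convex combinations and need only be
   checked at proper colorings. *)
- move=> a y [N [p [t [pS t0 t1 ->]]]].
  have -> : gadget_functional c1 c2 a (\sum_i t i *: p i) =
      \sum_i t i * gadget_functional c1 c2 a (p i).
    rewrite /gadget_functional; under [RHS]eq_bigr do rewrite mulrDr mulr1 mulr_sumr.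
    rewrite big_split /= t1; congr +%R; rewrite [RHS]exchange_big /=.
    apply: eq_bigr => u _; under [RHS]eq_bigr do rewrite mulr_sumr.
    rewrite [RHS]exchange_big /=; apply: eq_bigr => c _.
    rewrite summxE mulr_sumr; apply: eq_bigr => i _; rewrite mxE.
    exact: mulrCA.
  apply: sumr_ge0 => i _; apply: mulr_ge0 => //.
  by have [X /coloringP[x prx ->] <-] := pS i; apply: gadget_functional_ge0.
- move=> b; exists 1%N, (fun=> solution_mx R (color_classes (gadget_coloring c0 c1 c2 b))), (fun=> 1).
  split=> //.
  + move=> _; exists (color_classes (gadget_coloring c0 c1 c2 b)) => //.
    exact/coloring_classes/gadget_coloring_proper.
  + by rewrite big_ord1.
  + by rewrite big_ord1 scale1r.
- by move=> a b; apply: gadget_functional_coloring.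
Qed.

(** * Growth estimates *)

Lemma bernoulli_ineq (R : realType) (x : R) (n : nat) :
  0 <= x -> 1 + n%:R * x <= (1 + x) ^+ n.
Proof.
move=> x0; elim: n => [|n IHn]; first by rewrite mul0r addr0 expr0.
rewrite exprS; apply: le_trans (_ : (1 + x) * (1 + n%:R * x) <= _).
  rewrite -natr1; have : 0 <= n%:R * (x * x) by rewrite !mulr_ge0.
  by lra.
by rewrite ler_wpM2l // addr_ge0.
Qed.

(* For m = (2c + 1) t, Bernoulli gives (15/11)^m >= (1 + t/3)^(2c + 1). *)
Lemma exponential_beats_polynomial (R : realType) (C c K : nat) :
  exists2 m : nat, (K <= m)%N &
    (2 * (C * (m + m * m * 2) ^ c) + 1)%:R < (15 / 11 : R) ^+ m.
Proof.
(* The polynomial has degree [2 * c] in [t], one less than [e]; the surplus power of [t] absorbs the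
   constants [D] and [3 ^ e], and [K] makes [m] large enough. *)
pose e := (2 * c).+1; pose D := (2 * (C * (3 * e ^ 2) ^ c) + 1)%N.
pose t := (D * 3 ^ e + K)%N.
have t0 : (0 < t)%N by rewrite /t /D; have := expn_gt0 3 e; nia.
exists (e * t)%N; first by rewrite /e /t; nia.
have le1 : (2 * (C * (e * t + e * t * (e * t) * 2) ^ c) + 1 <= D * t ^ (2 * c))%N.
  have le0 : ((e * t + e * t * (e * t) * 2) ^ c <= (3 * e ^ 2) ^ c * t ^ (2 * c))%N.
    have [->|c0] := posnP c; first by rewrite muln0 !expn0.
    by rewrite expnM -expnMn leq_exp2r // -!mulnn; have : (0 < e)%N by []; nia.
  rewrite /D mulnDl; apply: leq_add; last by rewrite mul1n expn_gt0 t0.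
  move: (_ ^ c)%N ((3 * e ^ 2) ^ c)%N (t ^ _)%N le0 => X Y Z le0.
  by rewrite -mulnA leq_mul2l -mulnA leq_mul2l le0 !orbT.
apply: le_lt_trans (_ : (D * t ^ (2 * c))%:R < _); first by rewrite ler_nat.
rewrite [(e * t)%N]mulnC exprM.
apply: lt_le_trans (_ : (1 + t%:R * 3^-1) ^+ e <= _); last first.
  have q0 : 0 <= 15 / 11 :> R by rewrite divr_ge0.
  apply: lerXn2r; rewrite ?nnegrE ?addr_ge0 ?mulr_ge0 ?exprn_ge0 //.
  apply: (le_trans (bernoulli_ineq _ _)) => //.
  by apply: lerXn2r; rewrite ?nnegrE ?addr_ge0 //; lra.
apply: le_lt_trans (_ : (t%:R * 3^-1) ^+ e < _); last first.
  by rewrite ltrXn2r // ?nnegrE ?addr_ge0 ?mulr_ge0 // ltrDr.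
rewrite exprMn exprVn ler_pdivlMr ?exprn_gt0 // -!natrX -natrM ler_nat.
by rewrite mulnAC [(t ^ e)%N]expnS leq_mul2r leq_addr orbT.
Qed.

Lemma coloring_no_ext_formulation (R : realType) (d : nat) (f : nat -> R^o)
    (p : nat -> R) :
  (3 <= d)%N -> f =o_\oo (fun k : nat => k%:R : R^o) -> poly_bounded p ->
  no_ext_formulation (@coloring d) (fun k n => d%:R `^ f k * p n).
Proof.
move=> d3 fo [C [c pC]].
have d0 : 0 < d%:R :> R by rewrite ltr0n; lia.
have d1 : 1 < d%:R :> R by rewrite ltr1n; lia.
have lnd : 0 < ln d%:R :> R by rewrite ln_gt0.
(* As 3/2 = (11/10)(15/11), this rate leaves the factor (15/11)^m to beat the polynomial. *)
pose eps : R := ln (11 / 10) / ln d%:R.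
have eps0 : 0 < eps by rewrite divr_gt0 // ln_gt0 //; lra.
have deps : d%:R `^ eps = 11 / 10.
  rewrite /powR (gt_eqF d0) /eps -mulrA mulVf ?gt_eqF // mulr1 lnK // posrE; lra.
have [K _ fK] : \forall k \near \oo, `|f k| <= eps * `|k%:R : R^o|.
  by move/eqoP: fo; apply.
have [m Km big] := exponential_beats_polynomial R C c K.
exists m.+1, #|gadget_vertex m|, (gadget m); split; first exact: gadget_treewidth.
move=> k Q QE r Qr; have := gadget_extension_complexity d3 QE Qr.
rewrite -(ler_nat R) natrM !natrX => rm.
have r1 : (3 / 2) ^+ m <= r.+1%:R :> R.
  by rewrite expr_div_n ler_pdivrMr // exprn_gt0.
have nE : #|gadget_vertex m| = (m + m * m * 2)%N.
  by rewrite card_sum !card_prod card_bool !card_ord.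
set N := #|gadget_vertex m|.
have fm : d%:R `^ f m.+1 <= (11 / 10) ^+ m.+1.
  apply: le_trans (_ : d%:R `^ (eps * m.+1%:R) <= _).
    apply: ler_powR; first exact: ltW.
    apply: (le_trans (ler_norm _)); rewrite (le_trans (fK m.+1 _)) //=.
      by rewrite leqW.
    by rewrite normr_nat.
  by rewrite powRrM deps powR_mulrn //; lra.
have pN : p N <= (C * N ^ c)%:R by rewrite natrM natrX.
apply: le_lt_trans (_ : (11 / 10) ^+ m.+1 * (C * N ^ c)%:R < _).
  apply: le_trans (_ : d%:R `^ f m.+1 * (C * N ^ c)%:R <= _).
    by rewrite ler_wpM2l // powR_ge0.
  by rewrite ler_wpM2r.
move: big; rewrite -nE -/N natrD natrM; move: (C * N ^ c)%N => P big.
have e1 : 1 <= (11 / 10) ^+ m :> R by rewrite exprn_ege1 //; lra.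
(* The 2 absorbs the additional 11/10 from the exponent [m.+1], and the summand 1 absorbs the gap
   between [r.+1] and [r]. *)
have : (11 / 10) ^+ m * (2 * P%:R + 1) < (3 / 2) ^+ m :> R.
  have -> : 3 / 2 = (11 / 10) * (15 / 11) :> R by field.
  by rewrite [X in _ < X]exprMn ltr_pM2l // (lt_le_trans _ e1).
move: r1; rewrite -natr1 exprS.
set X := ((3 / 2) ^+ m : R); set Y := ((11 / 10) ^+ m : R) in e1 *; move=> le1 lt1.
have : 0 <= P%:R * Y by rewrite mulr_ge0 // (le_trans _ e1).
by lra.
Qed.

(** * Elimination orders from tree decompositions *)

Definition avoiding (T : finType) (t : rel T) (x : T) : rel T :=
  [rel a b | [&& t a b, a != x & b != x]].

Lemma avoiding_sym (T : finType) (t : sgraph T) x : symmetric (avoiding t x).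
Proof. by move=> a b; rewrite /avoiding /= (adj_sym t) [(a != x) && _]andbC. Qed.

(** A simple path from [y] to a different [y'] avoiding [x] would close up through [x] to a cycle of
    length at least 3. *)
Lemma tree_cut (T : finType) (t : sgraph T) (x y y' : T) : is_tree t ->
  t x y -> t x y' -> connect (avoiding t x) y y' -> y = y'.
Proof.
move=> [_ _ acyc] xy xy' /connectP[p0 pth0 lst0].
move: lst0; case: (shortenP pth0) => p pth up _ lst; apply/eqP.
case: p pth up lst => [|z p] pth up lst; first by rewrite lst.
have avoid (q : seq T) w : path (avoiding t x) w q -> w != x -> x \notin w :: q.
  elim: q w => [|a q IHq] w /=; first by rewrite !inE eq_sym.
  move=> /andP[/and3P[_ _ ax] pq] wx; rewrite inE negb_or eq_sym wx.
  exact: IHq.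
have yx : y != x by apply: contraTneq xy => ->; rewrite (adj_irr t).
have sub : path t y (z :: p).
  by apply: sub_path pth => a b /and3P[].
have := acyc [:: x, y, z & p]; rewrite /ucycle cons_uniq avoid // up /= andbT.
rewrite rcons_path; move: sub lst => /= /andP[-> ->] <- /=.
by rewrite xy (adj_sym t) xy' => /(_ isT).
Qed.

(** [dep] is the distance to a root and [par] a neighbour nearer to it. Shortest paths to the root
    from [j] and from [par i] avoid [i], since the depth drops at each step. A [j] as assumed also
    shows that [i] is not the root, where [par] takes a default value. *)
Lemma rooted_tree (T : finType) (t : sgraph T) : is_tree t ->
  exists (dep : T -> nat) (par : T -> T), forall i j, j != i ->
    (dep j <= dep i)%N ->
    [/\ t i (par i), (dep (par i) < dep i)%N &
        connect (avoiding t i) j (par i)].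
Proof.
move=> [/card_gt0P[r _] conn _].
pose D x n := [exists p : n.-tuple T, path t x p && (last x p == r)].
have DP x n : reflect (exists p, [/\ size p = n, path t x p & last x p = r]) (D x n).
  apply: (iffP existsP) => [[p /andP[pth /eqP lst]]|[p [/eqP sz pth lst]]].
    by exists p; rewrite size_tuple.
  by exists (Tuple sz); rewrite /= pth lst eqxx.
have ex x : exists n, D x n.
  by have /connectP[p pth lst] := conn x r; exists (size p); apply/DP; exists p.
pose dep x := ex_minn (ex x).
have depP x : D x (dep x) by rewrite /dep; case: ex_minnP.
have dep_min x n : D x n -> (dep x <= n)%N by rewrite /dep; case: ex_minnP => k _; apply.
have closer x : x != r -> exists2 y, t x y & (dep y < dep x)%N.
  have /DP[[|y p] [sz pth lst]] := depP x; first by rewrite -lst eqxx.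
  move=> _; move: pth => /= /andP[xy pth]; exists y => //.
  by rewrite -sz /= ltnS; apply/dep_min/DP; exists p.
have toroot i j : j != i -> (dep j <= dep i)%N -> connect (avoiding t i) j r.
  elim: (dep j).+1 {-2}j (ltnSn (dep j)) => // n IHn {}j jn ji le_ji.
  have [->|jr] := eqVneq j r; first exact: connect0.
  have [y jy lt_yj] := closer j jr.
  have yi : y != i by apply: contraTneq lt_yj => ->; rewrite -leqNgt.
  apply: (@connect_trans _ _ y); first by apply: connect1; rewrite /avoiding /= jy ji yi.
  by apply: IHn => //; [exact: leq_trans lt_yj jn | exact: ltnW (leq_trans lt_yj le_ji)].
exists dep, (fun i => odflt i [pick y | t i y && (dep y < dep i)%N]) => i j ji le_ji.
have ir : i != r.
  apply: contraNneq ji => ir; move: le_ji; rewrite ir.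
  have -> : dep r = 0%N.
    by apply/eqP; rewrite -leqn0; apply/dep_min/DP; exists [::].
  rewrite leqn0 => /eqP dj; have /DP[[|? ?] [sz _ <-//]] := depP j.
  by rewrite dj in sz.
case: pickP => [y /andP[iy lt_yi]|none] /=; last first.
  by have [y iy lt_yi] := closer i ir; have := none y; rewrite iy lt_yi.
split=> //; apply: connect_trans (toroot _ _ ji le_ji) _.
rewrite (sym_connect_sym (avoiding_sym t i)).
by apply: toroot; [apply: contraTneq lt_yi => ->; rewrite ltnn | apply: ltnW].
Qed.

(** [top v] is a bag of least depth containing [v]. Climbing from a common bag towards [top v], one
    cannot lose [u], whose top is no deeper. *)
Lemma bag_top (V T : finType) (G : sgraph V) (t : sgraph T) (B : T -> {set V}) :
  tree_decomposition G t B ->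
  exists (dep : T -> nat) (top : V -> T),
    (forall v, v \in B (top v)) /\
    forall u v i, u \in B i -> v \in B i ->
      (dep (top u) <= dep (top v))%N -> u \in B (top v).
Proof.
move=> [tree vert edge sub].
have [dep [par parP]] := rooted_tree tree.
have /choice[top topP] : forall v, exists i, v \in B i /\
    forall j, v \in B j -> (dep i <= dep j)%N.
  move=> v; have [i0 vi0] := vert v.
  case: (@arg_minnP _ i0 (fun i => v \in B i) dep vi0) => i vi imin.
  by exists i.
(* The path from [i] to [top v] through bags containing [v] leaves [i] by a neighbour joined to
   [par i] without passing through [i]; by [tree_cut] this neighbour is [par i]. *)
have up v i : v \in B i -> i != top v ->
    v \in B (par i) /\ (dep (par i) < dep i)%N.
  move=> vi itop; have [vtop top_min] := topP v.
  have [] := parP i (top v); rewrite 1?eq_sym // ?top_min //.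
  move=> ipar lt_par cpar; split=> //.
  have /connectP[p0 pth0 lst0] := sub v i (top v) vi vtop.
  move: lst0; case: (shortenP pth0) => p pth + _ lst.
  case: p pth lst => [|y p] /=; first by move=> _ /eqP; rewrite eq_sym (negbTE itop).
  move=> /andP[/and3P[iy _ vy] pth] lst /andP[ip _].
  suff <- : y = par i by [].
  apply: (tree_cut tree iy ipar); apply: connect_trans cpar.
  apply/connectP; exists p => //.
  elim: p y {iy vy lst} ip pth => //= a p IHp y.
  rewrite !inE !negb_or => /and3P[iy ia ip] /andP[/and3P[ya _ _] pth].
  rewrite /avoiding /= ya ![_ == i]eq_sym iy ia /=; apply: IHp => //.
  by rewrite inE negb_or ia.
exists dep, top; split=> [v|u v i]; first by have [] := topP v.
elim: (dep i).+1 {-2}i (ltnSn (dep i)) => // n IHn {}i lt_in ui vi le_uv.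
have [<-//|itop] := eqVneq i (top v).
have [vpar lt_par] := up v i vi itop.
have utop : i != top u.
  apply: contraTneq lt_par => iu; rewrite -leqNgt {1}iu (leq_trans le_uv) //.
  by have [_] := topP v; apply.
have [upar _] := up u i ui utop.
by apply: (IHn (par i)) => //; exact: leq_trans lt_par lt_in.
Qed.

(* Eliminating the vertices by decreasing [rk], the set [A v] consists of v and
   its higher neighbours in the chordal completion. *)
Lemma elimination_order (V : finType) (G : sgraph V) (k : nat) :
  treewidth_le G k ->
  exists (rk : V -> nat) (A : V -> {set V}),
    [/\ injective rk,
        forall v, v \in A v /\ (#|A v| <= k.+1)%N,
        forall u v, u \in A v -> (rk u <= rk v)%N,
        forall u v, G u v -> (rk u <= rk v)%N -> u \in A v &
        forall u v w, u \in A v -> w \in A v -> (rk u <= rk w)%N -> u \in A w].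
Proof.
move=> [T [t [B [td width]]]]; have [dep [top [vtop topP]]] := bag_top td.
(* The order is by depth of the top bag, with the enumeration rank as a base-[#|V|] digit breaking
   ties. *)
pose rk v := (dep (top v) * #|V| + enum_rank v)%N.
have ltV (v : V) : (enum_rank v < #|V|)%N by [].
have rkE v : (rk v %/ #|V|)%N = dep (top v).
  by rewrite divnMDl ?divn_small ?addn0 // (leq_trans _ (ltV v)).
have rk_dep u v : (rk u <= rk v)%N -> (dep (top u) <= dep (top v))%N.
  by move=> /(leq_div2r #|V|); rewrite !rkE.
exists rk, (fun v => [set u in B (top v) | (rk u <= rk v)%N]%SET); split.
- move=> u v /(congr1 (modn^~ #|V|)); rewrite /rk !modnMDl !modn_small //.
  by move=> /ord_inj/enum_rank_inj.
- move=> v; rewrite inE vtop leqnn; split=> //.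
  apply: leq_trans (width (top v)); apply: subset_leq_card.
  by apply/fintype.subsetP => u; rewrite inE => /andP[].
- by move=> u v; rewrite inE => /andP[].
- move=> u v Guv le_uv; rewrite inE le_uv andbT.
  have [i /andP[ui vi]] := td_edge td Guv.
  exact: topP ui vi (rk_dep _ _ le_uv).
- move=> u v w; rewrite !inE => /andP[uv _] /andP[wv _] le_uw; rewrite le_uw andbT.
  exact: topP uv wv (rk_dep _ _ le_uw).
Qed.

(** * Nonnegative local marginals *)

(** The affine hull is [D x0] plus the span of the differences [D x - D x0], and a cokernel matrix
    cuts out that span. When [P] is empty, the system is 0 = 1. *)
Lemma affine_hull_eqs (R : realType) (X : finType) (P : pred X) (m : nat)
    (D : X -> 'cV[R]_m) :
  exists (q : nat) (C : 'M[R]_(q, m)) (e : 'cV[R]_q), forall y,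
    C *m y = e <-> exists c : X -> R,
      [/\ forall x, ~~ P x -> c x = 0, \sum_x c x = 1 & y = \sum_x c x *: D x].
Proof.
have [x0 Px0|P0] := pickP P; last first.
  exists 1%N, 0, 1 => y; rewrite mul0mx; split=> [/matrixP/(_ 0 0)/eqP|[c [c0 c1 _]]].
    by rewrite !mxE eq_sym oner_eq0.
  move: c1; rewrite big1 => [/eqP|x _]; first by rewrite eq_sym oner_eq0.
  by rewrite c0 // P0.
pose W : 'M[R]_(#|X|, m) :=
  \matrix_k (if P (enum_val k) then (D (enum_val k) - D x0)^T else 0).
have WE (u : 'rV_#|X|) : u *m W =
    \sum_(x | P x) u 0 (enum_rank x) *: (D x - D x0)^T.
  rewrite mulmx_sum_row [RHS]big_mkcond /=.
  pose F x := if P x then u 0 (enum_rank x) *: (D x - D x0)^T else 0.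
  rewrite -[RHS]/(\sum_x F x) (big_enum_val F).
  by apply: eq_bigr => k _; rewrite rowK /F enum_valK; case: ifP; rewrite ?scaler0.
have sumP (c : X -> R) : (forall x, ~~ P x -> c x = 0) -> \sum_x c x = 1 ->
    \sum_x c x *: D x - D x0 = \sum_(x | P x) c x *: (D x - D x0).
  move=> cP c1; rewrite -{1}[D x0]scale1r -c1 scaler_suml -sumrB.
  rewrite [LHS](bigID P) /= [X in _ + X]big1 ?addr0 => [|x /cP->].
    by apply: eq_bigr => x _; rewrite scalerBr.
  by rewrite !scale0r subrr.
exists m, (cokermx W)^T, ((cokermx W)^T *m D x0) => y.
have -> : (cokermx W)^T *m y = (cokermx W)^T *m D x0 <-> ((y - D x0)^T <= W)%MS.
  rewrite submxE; split=> [/eqP|/eqP/(congr1 trmx)].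
    rewrite -subr_eq0 -mulmxBr => /eqP/(congr1 trmx).
    by rewrite trmx_mul trmxK trmx0 => ->.
  by rewrite trmx_mul trmxK trmx0 mulmxBr => /eqP; rewrite subr_eq0 => /eqP.
split=> [/submxP[u]|[c [cP c1 yE]]].
  rewrite WE => /(congr1 trmx); rewrite trmxK linear_sum /=.
  under eq_bigr do rewrite linearZ /= trmxK.
  move=> yE.
  pose s := \sum_(x | P x) u 0 (enum_rank x).
  (* Placing the missing mass [1 - s] on [x0] is free, since its difference vector is zero. *)
  pose c x := (if P x then u 0 (enum_rank x) else 0) + (x == x0)%:R * (1 - s).
  have cP x : ~~ P x -> c x = 0.
    move=> nPx; rewrite /c (negbTE nPx); case: eqP => [xx0|_]; last by rewrite mul0r addr0.
    by rewrite xx0 Px0 in nPx.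
  have c1 : \sum_x c x = 1.
    rewrite big_split /= -big_mkcond /= -/s -mulr_suml.
    rewrite (bigD1 x0) //= eqxx big1 ?addr0; last by move=> x /negbTE->.
    by rewrite mul1r addrC subrK.
  exists c; split=> //; apply: (addIr (- D x0)); rewrite sumP // yE.
  apply: eq_bigr => x Px.
  rewrite /c Px; have [->|_] := eqVneq x x0; first by rewrite subrr !scaler0.
  by rewrite mul0r addr0.
apply/submxP; exists (\row_k c (enum_val k)); rewrite WE yE sumP // linear_sum /=.
by apply: eq_bigr => x _; rewrite linearZ /= mxE enum_rankK.
Qed.

Definition restr (V C : finType) (c0 : C) (S : {set V}) (x : {ffun V -> C}) :
    {ffun V -> C} :=
  [ffun u => if u \in S then x u else c0].

Section Marginals.
Variables (R : realType) (V C : finType) (c0 : C).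
Implicit Types (s x z : {ffun V -> C}) (S : {set V}) (c : {ffun V -> C} -> R).

Lemma restrP S x z :
  reflect (forall u, u \in S -> x u = z u) (restr c0 S x == restr c0 S z).
Proof.
apply: (iffP eqP) => [/ffunP xz u uS|xz].
  by have := xz u; rewrite !ffunE uS.
by apply/ffunP => u; rewrite !ffunE; case: ifP => // /xz.
Qed.

Lemma restr_id S x : restr c0 S (restr c0 S x) = restr c0 S x.
Proof. by apply/ffunP => u; rewrite !ffunE; case: (u \in S). Qed.

(** The weights [c] may be negative; a point of the affine hull only controls their sums over bag
    restrictions. *)
Definition marginal c S z : R := \sum_(x | restr c0 S x == restr c0 S z) c x.

Lemma marginal_eq c S z z' : (forall u, u \in S -> z u = z' u) ->
  marginal c S z = marginal c S z'.
Proof. by move=> zz'; rewrite /marginal (eqP (introT (restrP S z z') zz')). Qed.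

Lemma marginal0 c z : marginal c finset.set0 z = \sum_x c x.
Proof. by apply: eq_bigl => x; apply/restrP => u; rewrite inE. Qed.

Lemma marginal_subset c S S' z : S \subset S' -> marginal c S z =
  \sum_(s | (restr c0 S' s == s) && (restr c0 S s == restr c0 S z)) marginal c S' s.
Proof.
move=> /fintype.subsetP SS'; rewrite /marginal.
rewrite (partition_big (restr c0 S')
  (fun s => (restr c0 S' s == s) && (restr c0 S s == restr c0 S z))) /=.
  apply: eq_bigr => s /andP[/eqP s1 /restrP s2]; apply: eq_bigl => x.
  rewrite -{1}s1; apply/andP/idP => [[]//|xs]; split=> //.
  apply/restrP => u uS; rewrite -s2 //; move/restrP: xs; apply; exact: SS'.
move=> x /restrP xz; rewrite restr_id eqxx; apply/restrP => u uS.
by rewrite ffunE SS' // xz.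
Qed.

Lemma marginal_gt0_subset c S S' z : S \subset S' ->
  (forall s, 0 <= marginal c S' s) -> 0 < marginal c S' z -> 0 < marginal c S z.
Proof.
move=> SS' ge0 gt0; rewrite (marginal_subset _ _ SS') (bigD1 (restr c0 S' z)) /=.
  rewrite ltr_wpDr ?sumr_ge0 // (marginal_eq _ (z' := z)) // => u uS'.
  by rewrite ffunE uS'.
rewrite restr_id eqxx; apply/restrP => u uS.
by rewrite ffunE (fintype.subsetP SS').
Qed.

Lemma marginal_gt0_superset c S S' z : S \subset S' ->
  0 < marginal c S z ->
  exists s : {ffun V -> C}, (forall u, u \in S -> s u = z u) /\ 0 < marginal c S' s.
Proof.
move=> SS' gt0.
have [s /andP[/restrP sz s0]|none] :=
    pickP (fun s => (restr c0 S s == restr c0 S z) && (0 < marginal c S' s)).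
  by exists s.
move: gt0; rewrite (marginal_subset _ _ SS') ltNge sumr_le0 // => s /andP[_ sz].
by have := none s; rewrite sz /= ltNge => /negbFE.
Qed.

Section Elimination.
Variables (rk : V -> nat) (A : V -> {set V}).
Hypotheses (rk_inj : injective rk)
  (A_rk : forall u v, u \in A v -> (rk u <= rk v)%N)
  (A_clique : forall u v w,
     u \in A v -> w \in A v -> (rk u <= rk w)%N -> u \in A w).

(** Colors are fixed by increasing [rk]. The rest of [A v] lies in the bag of its highest vertex,
    where positivity is already known, so some value at [v] keeps the marginal on [A v] positive.
    Bags of lower rank do not contain [v]. *)
Lemma greedy_extension c : (forall v z, 0 <= marginal c (A v) z) ->
  0 < \sum_x c x -> exists z, forall v, 0 < marginal c (A v) z.
Proof.
move=> ge0 gt0.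
have [z zP] : exists z, forall v, (rk v < (\max_v rk v).+1)%N ->
    0 < marginal c (A v) z.
  elim: (_.+1) => [|j [z zP]]; first by exists [ffun=> c0].
  have [v /eqP vj|none] := pickP (fun v => rk v == j); last first.
    exists z => v; rewrite ltnS leq_eqVlt => /orP[/eqP vj|]; last exact: zP.
    by have := none v; rewrite vj eqxx.
  pose S := A v :\ v.
  have SA : S \subset A v by apply: subD1set.
  have S0 : 0 < marginal c S z.
    have [w0 w0S|S0] := pickP (mem S); last first.
      have -> : S = finset.set0 by apply/setP => u; rewrite [RHS]inE; exact: S0.
      by rewrite marginal0.
    have [w wS wmax] := @arg_maxnP _ w0 (fun w => w \in S) rk w0S.
    have /andP[wv wA] : (w != v) && (w \in A v) by move: wS; rewrite !inE.
    have lt_w : (rk w < j)%N.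
      by rewrite -vj ltn_neqAle A_rk // andbT; apply: contra wv => /eqP/rk_inj->.
    apply: (marginal_gt0_subset (S' := A w)) => //; last exact: zP.
    apply/fintype.subsetP => u uS; apply: (A_clique _ wA); last exact: wmax.
    exact: fintype.subsetP SA _ uS.
  have [s [sz s0]] := marginal_gt0_superset SA S0.
  exists [ffun u => if u == v then s v else z u] => w.
  rewrite ltnS leq_eqVlt => /orP[/eqP wj|lt_wj].
    have -> : w = v by apply: rk_inj; rewrite wj vj.
    rewrite (marginal_eq _ (z' := s)) // => u uA; rewrite ffunE.
    by have [->//|uv] := eqVneq u v; rewrite sz // !inE uv.
  rewrite (marginal_eq _ (z' := z)) ?zP // => u uA; rewrite ffunE.
  case: eqP => // uv; move: (A_rk uA); rewrite uv vj.
  by rewrite leqNgt lt_wj.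
by exists z => v; apply: zP; rewrite ltnS leq_bigmax.
Qed.

(* Repeatedly subtract a multiple of an assignment all of whose marginals are
   positive, until one more marginal vanishes. *)
Lemma marginals_nonneg_measure c (P : pred {ffun V -> C}) :
  (forall x, ~~ P x -> c x = 0) ->
  (forall z : {ffun V -> C}, (forall v, exists2 x, P x & forall u, u \in A v -> x u = z u) -> P z) ->
  (forall v z, 0 <= marginal c (A v) z) -> 0 <= \sum_x c x ->
  exists a : {ffun V -> C} -> R,
    [/\ forall x, 0 <= a x, forall x, ~~ P x -> a x = 0,
        \sum_x a x = \sum_x c x &
        forall v z, marginal a (A v) z = marginal c (A v) z].
Proof.
move=> cP Ploc.
(* The index [None] treats the total mass as one more marginal, so that the step size below cannot
   exceed it. *)
pose AA (o : option V) := if o is Some v then A v else finset.set0.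
pose supp c := [set p : option V * {ffun V -> C} | marginal c (AA p.1) p.2 != 0]%SET.
move: {2}#|supp c|.+1 (ltnSn #|supp c|) => n.
elim: n c cP => // n IHn c cP lt_n ge0 s_ge0.
have [s0|s_gt0] := eqVneq (\sum_x c x) 0.
  exists (fun=> 0); split=> // [|v z]; first by rewrite big1 ?s0.
  rewrite {1}/marginal big1 //; apply/esym/eqP; rewrite eq_le ge0 andbT leNgt.
  apply/negP => /(marginal_gt0_subset (finset.sub0set _) (ge0 v)).
  by rewrite marginal0 s0 ltxx.
have {s_gt0}s_gt0 : 0 < \sum_x c x by rewrite lt_neqAle eq_sym s_gt0.
have [z zP] := greedy_extension ge0 s_gt0.
have zAA o : 0 < marginal c (AA o) z by case: o => [v|] //=; rewrite marginal0.
(* A positive marginal contains some [x] with [c x] nonzero, hence in [P]; so [z] agrees with a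
   member of [P] on every bag. *)
have Pz : P z.
  apply: Ploc => v; have [x /andP[Px /restrP xz]|none] :=
      pickP (fun x => P x && (restr c0 (A v) x == restr c0 (A v) z)).
    by exists x.
  have := zP v; rewrite /marginal big1 ?ltxx // => x xz; apply: cP.
  by have := none x; rewrite xz andbT => ->.
(* Subtracting the smallest marginal at [z] keeps all marginals nonnegative and removes [(w, z)]
   from the support. *)
have [w _ wmin] := @arg_minP _ _ _ None predT (fun o => marginal c (AA o) z) isT.
set eps := marginal c (AA w) z in wmin.
have dirac S x : \sum_(y | restr c0 S y == restr c0 S x) (y == z)%:R =
    (restr c0 S z == restr c0 S x)%:R :> R.
  rewrite big_mkcond (bigD1 z) //= eqxx big1 ?addr0; first by case: ifP.
  by move=> y /negbTE ->; case: ifP.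
pose c' x := c x - eps * (x == z)%:R.
have mg' S x : marginal c' S x =
    marginal c S x - eps * (restr c0 S z == restr c0 S x)%:R.
  by rewrite /marginal sumrB -mulr_sumr dirac.
have sum' : \sum_x c' x = \sum_x c x - eps.
  rewrite -!(marginal0 _ z) mg'; have -> : restr c0 finset.set0 z == restr c0 finset.set0 z by [].
  by rewrite mulr1.
have ge0' p x : 0 <= marginal c (AA p) x -> 0 <= marginal c' (AA p) x.
  rewrite mg'; case: (boolP (_ == _)) => [/restrP xz _|_]; last by rewrite mulr0 subr0.
  by rewrite mulr1 subr_ge0 -(marginal_eq _ xz) wmin.
have [||||a' [a0 aP aS aM]] := IHn c'.
- move=> x nPx; rewrite /c' cP // add0r; case: eqP => [xz|_]; last by rewrite mulr0 oppr0.
  by rewrite xz Pz in nPx.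
- rewrite -ltnS; apply: leq_trans lt_n; rewrite ltnS; apply: proper_card.
  apply/properP; split.
    apply/fintype.subsetP => -[p x]; rewrite !inE /= mg'; apply: contraNneq => m0.
    case: (boolP (restr c0 _ z == _)) => [/restrP xz|_]; last by rewrite mulr0 subr0 m0.
    by have := zAA p; rewrite (marginal_eq _ xz) m0 ltxx.
  exists (w, z); first by rewrite inE /= gt_eqF // zAA.
  by rewrite inE negbK /= mg' eqxx mulr1 subrr.
- by move=> v x; apply: (ge0' (Some v)); apply: ge0.
- by rewrite -(marginal0 _ z); apply: (ge0' None); rewrite marginal0.
have eps0 : 0 < eps by apply: zAA.
exists (fun x => a' x + eps * (x == z)%:R); split.
- by move=> x; rewrite addr_ge0 // mulr_ge0 // ltW.
- move=> x nPx; rewrite aP // add0r; case: eqP => [xz|_]; last by rewrite mulr0.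
  by rewrite xz Pz in nPx.
- rewrite big_split /= aS sum' -mulr_sumr.
  rewrite -[X in _ * X](marginal0 (fun x => (x == z)%:R) z) /marginal dirac eqxx.
  by rewrite mulr1 subrK.
- move=> v x; rewrite /marginal big_split /= -/(marginal a' (A v) x) aM mg'.
  by rewrite -mulr_sumr dirac subrK.
Qed.

End Elimination.
End Marginals.

(** * The extended formulation *)

Definition pairing_mx (R : realType) (m p n : nat) (W : 'I_p -> 'I_n -> 'rV[R]_m)
    (y : 'cV[R]_m) : 'M[R]_(p, n) :=
  \matrix_(i, j) (W i j *m y) 0 0.

Lemma pairing_mx_linear (R : realType) m p n (W : 'I_p -> 'I_n -> 'rV[R]_m) :
  linear (pairing_mx W).
Proof.
move=> a y z; apply/matrixP => i j; rewrite [LHS]mxE mulmxDr -scalemxAr.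
by rewrite !mxE.
Qed.

HB.instance Definition _ (R : realType) m p n (W : 'I_p -> 'I_n -> 'rV[R]_m) :=
  GRing.isLinear.Build R 'cV[R]_m 'M[R]_(p, n) _ (pairing_mx W)
    (pairing_mx_linear W).

(* A coloring of a bag is encoded by its extension to all vertices by c0. *)
Definition bag_coloring (V C : finType) (c0 : C) (A : V -> {set V}) : finType :=
  {p : V * {ffun V -> C} | restr c0 (A p.1) p.2 == p.2}.

(** Extended by [c0], the colorings of [A v] are functions supported in [A v], at most [#|C| ^ k]
    for each [v]. *)
Lemma card_bag_coloring (V C : finType) (c0 : C) (A : V -> {set V}) (k : nat) :
  (forall v, (#|A v| <= k)%N) ->
  (#|bag_coloring c0 A| <= #|V| * #|C| ^ k)%N.
Proof.
move=> Ak; rewrite card_sig -sum1_card.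
rewrite -(pair_big_dep predT (fun v s => restr c0 (A v) s == s) (fun _ _ => 1%N)) /=.
rewrite -sum_nat_const; apply: leq_sum => v _; rewrite sum1_card.
have C0 : (0 < #|C|)%N by apply/card_gt0P; exists c0.
apply: leq_trans (leq_pexp2l C0 (Ak v)).
rewrite -(card_pffun_on c0 (A v) C); apply: subset_leq_card.
apply/fintype.subsetP => s sP; have /eqP sE : restr c0 (A v) s == s by exact: sP.
apply/pffun_onP; split=> //; apply/supportP => u /negbTE uA.
by rewrite -sE ffunE uA.
Qed.

Section TreewidthFormulation.
Variables (R : realType) (d n : nat) (c0 : 'I_d) (G : sgraph 'I_n).
Variables (rk : 'I_n -> nat) (A : 'I_n -> {set 'I_n}).
Hypotheses (rk_inj : injective rk) (A_refl : forall v, v \in A v)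
  (A_rk : forall u v, u \in A v -> (rk u <= rk v)%N)
  (A_edge : forall u v, G u v -> (rk u <= rk v)%N -> u \in A v)
  (A_clique : forall u v w,
     u \in A v -> w \in A v -> (rk u <= rk w)%N -> u \in A w).

Let I : finType := bag_coloring c0 A.
Let X : finType := {ffun 'I_n -> 'I_d}.
Let node (k : 'I_#|I|) : 'I_n := (val (enum_val k : I)).1.
Let local (k : 'I_#|I|) : X := (val (enum_val k : I)).2.

Let localE k : restr c0 (A (node k)) (local k) = local k.
Proof. by apply/eqP; apply: (valP (enum_val k : I)). Qed.

Definition local_indicator (x : X) : 'cV[R]_#|I| :=
  \col_k (restr c0 (A (node k)) x == local k)%:R.

(** The color of [v] is read from its own bag [A v] only, where each coloring selects exactly one
    coordinate. *)
Definition color_reading (i : 'I_d) (v : 'I_n) : 'rV[R]_#|I| :=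
  \row_k ((node k == v) && (local k v == i))%:R.

Let pairing_local_indicator x :
  pairing_mx color_reading (local_indicator x) = solution_mx R (color_classes x).
Proof.
apply/matrixP => i v; rewrite solution_mx_classes !mxE.
have pf : restr c0 (A v) (restr c0 (A v) x) == restr c0 (A v) x by rewrite restr_id.
pose k0 : 'I_#|I| := enum_rank (Sub (v, restr c0 (A v) x) pf : I).
have nk0 : node k0 = v by rewrite /node /k0 enum_rankK.
have lk0 : local k0 = restr c0 (A v) x by rewrite /local /k0 enum_rankK.
rewrite (bigD1 k0) //= big1 => [|k kk0].
  by rewrite addr0 !mxE nk0 lk0 !eqxx ffunE A_refl mulr1.
rewrite !mxE; case: eqP => /= [nk|_]; last by rewrite mul0r.
case: (restr c0 _ x =P _) => [lk|_]; last by rewrite mulr0.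
case/eqP: kk0; apply: enum_val_inj; rewrite enum_rankK; apply: val_inj => /=.
by rewrite [LHS]surjective_pairing -/(node k) -/(local k) -lk nk.
Qed.

Let sum_local_indicator (c : X -> R) k :
  (\sum_x c x *: local_indicator x) k 0 = marginal c0 c (A (node k)) (local k).
Proof.
rewrite summxE /marginal [RHS]big_mkcond /=; apply: eq_bigr => x _.
by rewrite !mxE localE; case: ifP; rewrite ?mulr1 ?mulr0.
Qed.

Lemma coloring_formulation :
  exists (m : nat) (Q : set 'cV[R]_m),
    [/\ extended_formulation (solution_polytope R (@coloring d) G) Q,
        defined_by_ineqs Q m & m = #|bag_coloring c0 A|].
Proof.
pose P (x : X) := proper_coloring G x.
have [q [C [e Ce]]] := affine_hull_eqs P local_indicator.
pose Q := [set y : 'cV[R]_#|I| | (forall k, ((- 1%:M) *m y) k 0 <= (0 : 'cV[R]_#|I|) k 0) /\ C *m y = e].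
have Qineq : defined_by_ineqs Q #|I|.
  by exists (- 1%:M), 0, q, C, e.
have QE y : Q y <-> (forall k, 0 <= y k 0) /\ C *m y = e.
  by split=> -[y0 ye]; split=> // k; have := y0 k;
    rewrite mulNmx mul1mx !mxE oppr_le0.
have Qconv y : Q y -> exists a : X -> R,
    [/\ forall x, 0 <= a x, forall x, ~~ P x -> a x = 0,
        \sum_x a x = 1 & y = \sum_x a x *: local_indicator x].
  move=> /QE[y0 /Ce[c [cP c1 yE]]].
  have mg v z : 0 <= marginal c0 c (A v) z.
    have pf : restr c0 (A v) (restr c0 (A v) z) == restr c0 (A v) z by rewrite restr_id.
    pose k : 'I_#|I| := enum_rank (Sub (v, restr c0 (A v) z) pf : I).
    have := y0 k; rewrite yE sum_local_indicator /node /local /k enum_rankK /=.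
    rewrite (marginal_eq _ _ (z' := z)) // => u uA.
    by rewrite ffunE uA.
  have [||a [a0 aP a1 aM]] :=
    marginals_nonneg_measure rk_inj A_rk A_clique cP _ mg; last first.
  - exists a; split=> //; first by rewrite a1.
    by rewrite yE; apply/colP => k; rewrite !sum_local_indicator aM.
  - by rewrite c1.
  (* Properness is local to bags: every edge lies in the bag of its end of higher rank. *)
  move=> z zP; apply/proper_coloringP.
  suff edge u v : G u v -> (rk u <= rk v)%N -> z u != z v.
    move=> u v Guv; have [/edge|/ltnW/edge] := leqP (rk u) (rk v); first exact.
    by rewrite eq_sym (adj_sym G); apply.
  move=> Guv le_uv; have [x /proper_coloringP prx xz] := zP v.
  by rewrite -!xz ?A_refl ?A_edge //; apply: prx.
exists #|I|, Q; split=> //; split; last first.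
  exists (pairing_mx color_reading); rewrite eqEsubset; split=> [M [y Qy <-]|M].
    have [a [a0 aP a1 ->]] := Qconv y Qy; apply/coloring_polytopeP.
    exists a; split=> //; rewrite linear_sum; apply: eq_bigr => x _.
    by rewrite linearZ /= pairing_local_indicator.
  move=> /coloring_polytopeP[a [a0 aP a1 ->]].
  exists (\sum_x a x *: local_indicator x).
    apply/QE; split; last by apply/Ce; exists a.
    by move=> k; rewrite sum_local_indicator sumr_ge0.
  rewrite linear_sum; apply: eq_bigr => x _.
  by rewrite linearZ /= pairing_local_indicator.
split; first by exists #|I|.
exists 1 => y Qy k; have [a [a0 aP a1 yE]] := Qconv y Qy.
have [y0 _] := (QE y).1 Qy; rewrite ger0_norm // yE sum_local_indicator -a1.
by rewrite /marginal big_mkcond ler_sum // => x _; case: ifP.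
Qed.

End TreewidthFormulation.

Theorem theorem6p8 (R : realType) (d : nat) (d_gt0 : (0 < d)%N) :
  (exists p : nat -> R, poly_bounded p /\
     has_ext_complexity (@coloring d) (fun k n => d%:R ^+ k * p n))
  /\
  ((3 <= d)%N -> ETH R ->
     forall (f : nat -> R^o) (p : nat -> R),
       f =o_\oo (fun k : nat => k%:R : R^o) -> poly_bounded p ->
       no_ext_formulation (@coloring d) (fun k n => d%:R `^ f k * p n)).
Proof.
split=> [|d3 _ f p]; last exact: coloring_no_ext_formulation.
(* The factor [d] accounts for bags of [k.+1] vertices, and [n] for the choice of the bag. *)
exists (fun n => d%:R * n%:R); split; first by exists d, 1%N.
move=> k n G /elimination_order[rk [A [rk_inj A_bag A_rk A_edge A_clique]]].
have [m [Q [QE Qm mE]]] := coloring_formulation R (Ordinal d_gt0) rk_inj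
  (fun v => (A_bag v).1) A_rk A_edge A_clique.
exists m, Q, m; split=> //; rewrite mE mulrA -exprSr -natrX -natrM ler_nat mulnC.
have := card_bag_coloring (Ordinal d_gt0) (fun v => (A_bag v).2).
by rewrite !card_ord.
Qed.
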